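(* Let $\{a_k\}_{k\in\mathbb{Z}}$ be a two-sided sequence of complex numbers and let $$A=\Bigl\{a_{m+n+1}\Bigl(\frac1{m+\frac12}+\frac1{n+\frac12}\Bigr)\Bigr\}_{m,n\in\mathbb{Z}}.$$ Suppose that $1<p<\infty$. The following are equivalent: (i) $A$ is a bounded operator on $\ell^2(\mathbb{Z})$; (ii) $A\in\boldsymbol{S}_p$; (iii) $\{a_k\}_{k\in\mathbb{Z}}\in\ell^2(\mathbb{Z})$.
   Context: Operators on $\ell^2(\mathbb{Z})$ are identified with their matrices with respect to the standard orthonormal basis of $\ell^2(\mathbb{Z})$. $\boldsymbol{S}_p$ is the Schatten--von Neumann class: bounded operators $T$ with $\sum_{n\ge0}s_n(T)^p<\infty$, where $s_n(T)=\inf\{\|T-R\|:\operatorname{rank}R\le n\}$. *)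

(* Defs.v *)
From HB Require Import structures.
From mathcomp Require Import all_boot all_order all_algebra.
From mathcomp Require Import all_classical all_reals ereal topology sequences.
From mathcomp Require Import esum exp.
From mathcomp Require Import ring.
From mathcomp Require Import complex.
Set Implicit Arguments.
Unset Strict Implicit.
Unset Printing Implicit Defensive.
Import Order.TTheory GRing.Theory Num.Theory.
Import ComplexField.Normc.

Local Open Scope classical_set_scope.
Local Open Scope ring_scope.

Definition square_summable (R : realType) (x : int -> R[i]) : Prop :=
  summable [set: int] (fun k => (normc (x k) ^+ 2)%:E).

Section ell2.
Context {R : realType}.
Implicit Types x y : int -> R[i].

(* [normc : R[i] -> R] is the modulus with values in [R]; the generic norm
   [`|z|] of a complex number has type [R[i]]. *)
Definition sqnorm x : \bar R := \esum_(k in [set: int]) (normc (x k) ^+ 2)%:E.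

Lemma square_summableE x : square_summable x <-> (sqnorm x < +oo)%E.
Proof.
rewrite /square_summable /summable /sqnorm.
by under eq_esum do rewrite gee0_abs ?lee_fin ?sqr_ge0//.
Qed.

Lemma sqnorm_ge0 x : (0 <= sqnorm x)%E.
Proof. by apply: esum_ge0 => k _; rewrite lee_fin sqr_ge0. Qed.

Lemma sqnorm0 : sqnorm (0 : int -> R[i]) = 0%E.
Proof. by apply: esum1 => k _; rewrite normc0 expr0n. Qed.

Lemma sqnorm_ge x k : ((normc (x k) ^+ 2)%:E <= sqnorm x)%E.
Proof.
apply: esum_ge; exists [set k]; first by split.
by rewrite fsbig_set1.
Qed.

Lemma le_sqnorm_lin (s t : R) x y z : 0 <= s -> 0 <= t ->
  (forall k, normc (z k) ^+ 2 <= s * normc (x k) ^+ 2 + t * normc (y k) ^+ 2) ->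
  (sqnorm z <= s%:E * sqnorm x + t%:E * sqnorm y)%E.
Proof.
move=> s0 t0 h; apply: ge_ereal_sup => _ [A [finA _] <-].
apply: (@le_trans _ _ (s%:E * (\sum_(k \in A) (normc (x k) ^+ 2)%:E)
  + t%:E * (\sum_(k \in A) (normc (y k) ^+ 2)%:E))%E).
  rewrite !ge0_mule_fsumr; last 2 first.
  - by move=> k; rewrite lee_fin sqr_ge0.
  - by move=> k; rewrite lee_fin sqr_ge0.
  rewrite -fsbig_split//; apply: lee_fsum => // k _ /=.
  by rewrite -!EFinM -EFinD lee_fin.
have le (w : int -> R[i]) :
    (\sum_(k \in A) (normc (w k) ^+ 2)%:E <= sqnorm w)%E.
  by apply: esum_ge; exists A; rewrite //; split.
by apply: leeD; apply: lee_wpmul2l; rewrite ?lee_fin.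
Qed.

Definition ell2_pred : {pred int -> R[i]} := [pred x | `[< square_summable x >]].

Lemma ell2_predE x : x \in ell2_pred -> (sqnorm x < +oo)%E.
Proof. by move=> h; apply/square_summableE; exact/asboolP. Qed.

Lemma normcD2 (s : R) (u v : R[i]) : 0 < s ->
  normc (u + v) ^+ 2 <= (1 + s) * normc u ^+ 2 + (1 + s^-1) * normc v ^+ 2.
Proof.
move=> s0; have ns : s != 0 by rewrite gt_eqF.
have : normc (u + v) ^+ 2 <= (normc u + normc v) ^+ 2.
  by rewrite lerXn2r ?nnegrE ?addr_ge0 ?le_normcD//;
    case: u => ? ?; case: v => ? ?; apply: sqrtr_ge0.
move/le_trans; apply; rewrite -subr_ge0.
set a := normc u; set b := normc v.
rewrite [X in 0 <= X](_ : _ = s^-1 * (s * a - b) ^+ 2); last by field.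
by rewrite mulr_ge0 ?sqr_ge0 // invr_ge0 ltW.
Qed.

Lemma ell2_submod_closed : submod_closed ell2_pred.
Proof.
split=> [|c x y].
  by apply/asboolP; apply/square_summableE; rewrite sqnorm0 ltry.
move=> /ell2_predE hx /ell2_predE hy.
apply/asboolP; apply/square_summableE.
apply: (@le_lt_trans _ _
  (((1 + 1) * normc c ^+ 2)%:E * sqnorm x + (1 + 1^-1)%:E * sqnorm y)%E).
  apply: le_sqnorm_lin => [||k].
  - by rewrite mulr_ge0 ?sqr_ge0.
  - by rewrite addr_ge0// invr_ge0.
  - apply: le_trans (@normcD2 1 (c * x k) (y k) ltr01) _.
    by rewrite normcM exprMn mulrA.
have fx : sqnorm x \is a fin_num by rewrite ge0_fin_numE ?sqnorm_ge0.
have fy : sqnorm y \is a fin_num by rewrite ge0_fin_numE ?sqnorm_ge0.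
by rewrite ltey_eq fin_numD !fin_numM.
Qed.

HB.instance Definition _ :=
  GRing.isSubmodClosed.Build R[i] (int -> R[i]) ell2_pred ell2_submod_closed.

End ell2.

Section ell2_type.
Variable R : realType.

Record ell2 : Type := Ell2
  { ell2_val :> int -> R[i] ; ell2_valP : ell2_val \in ell2_pred }.

HB.instance Definition _ := [isSub for ell2_val].
HB.instance Definition _ := [Choice of ell2 by <:].
HB.instance Definition _ := [SubChoice_isSubLmodule of ell2 by <:].

Implicit Types x y : ell2.

Definition ell2_norm x : R := Num.sqrt (fine (sqnorm x)).

Lemma ell2_sqnormE x : sqnorm x = (ell2_norm x ^+ 2)%:E.
Proof.
rewrite /ell2_norm sqr_sqrtr ?fine_ge0 ?sqnorm_ge0// fineK//.
by rewrite ge0_fin_numE ?sqnorm_ge0// ell2_predE// ell2_valP.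
Qed.

Lemma ell2_norm_ge0 x : 0 <= ell2_norm x.
Proof. exact: sqrtr_ge0. Qed.

Lemma ell2_norm_eq0 x : ell2_norm x = 0 -> x = 0.
Proof.
move=> x0; apply/val_inj/funext => k /=; apply: eq0_normc.
have := sqnorm_ge x k; rewrite ell2_sqnormE x0 expr0n lee_fin /= => h.
by apply/eqP; rewrite -sqrf_eq0; apply/eqP/le_anti; rewrite h sqr_ge0.
Qed.

Lemma ell2_normZ (c : R[i]) x : ell2_norm (c *: x) = normc c * ell2_norm x.
Proof.
have le (d : R[i]) (y : ell2) : ell2_norm (d *: y) <= normc d * ell2_norm y.
  have d0 : 0 <= normc d by case: d => ? ?; apply: sqrtr_ge0.
  rewrite -(@ler_pXn2r _ 2)// ?nnegrE ?mulr_ge0 ?ell2_norm_ge0//.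
  rewrite -lee_fin -ell2_sqnormE exprMn.
  apply: le_trans (@le_sqnorm_lin R (normc d ^+ 2) 0 y y _ _ _ _) _.
  - exact: sqr_ge0.
  - by [].
  - by move=> k /=; rewrite normcM exprMn mul0r addr0.
  - by rewrite mul0e adde0 ell2_sqnormE EFinM.
apply/le_anti; rewrite le //=.
have [->|c0] := eqVneq c 0; first by rewrite normc0 mul0r ell2_norm_ge0.
have := le c^-1 (c *: x); rewrite scalerA mulVf// scale1r normcV.
have n0 : 0 < normc c.
  rewrite lt_neqAle eq_sym (contra_neq (@eq0_normc _ c))//=.
  by case: c {c0} => ? ?; apply: sqrtr_ge0.
by rewrite mulrC ler_pdivlMr// mulrC.
Qed.

Lemma ell2_normD x y : ell2_norm (x + y) <= ell2_norm x + ell2_norm y.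
Proof.
have [/ell2_norm_eq0 ->|x0] := eqVneq (ell2_norm x) 0.
  by rewrite add0r lerDr ell2_norm_ge0.
have [/ell2_norm_eq0 ->|y0] := eqVneq (ell2_norm y) 0.
  by rewrite addr0 lerDl ell2_norm_ge0.
have xp : 0 < ell2_norm x by rewrite lt_def x0 ell2_norm_ge0.
have yp : 0 < ell2_norm y by rewrite lt_def y0 ell2_norm_ge0.
rewrite -(@ler_pXn2r _ 2)// ?nnegrE ?addr_ge0 ?ell2_norm_ge0//.
rewrite -lee_fin -ell2_sqnormE.
pose s := ell2_norm y / ell2_norm x.
have s0 : 0 < s by rewrite divr_gt0.
apply: le_trans (@le_sqnorm_lin R (1 + s) (1 + s^-1) x y _ _ _ _) _.
- by rewrite addr_ge0// ltW.
- by rewrite addr_ge0// invr_ge0 ltW.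
- by move=> k /=; exact: normcD2.
- rewrite !ell2_sqnormE -!EFinM -EFinD lee_fin le_eqVlt; apply/orP; left.
  by apply/eqP; rewrite /s; field; rewrite x0 y0.
Qed.

Lemma normc_nat n : normc (n%:R : R[i]) = n%:R.
Proof.
have -> : (n%:R : R[i]) = ((n%:R : R)%:C)%C by rewrite rmorph_nat.
by rewrite /normc /= expr0n addr0 sqrtr_sqr ger0_norm ?ler0n.
Qed.

Lemma ell2_normMn x n : ell2_norm (x *+ n) = ell2_norm x *+ n.
Proof. by rewrite -scaler_nat ell2_normZ normc_nat mulr_natl. Qed.

Lemma ell2_normN x : ell2_norm (- x) = ell2_norm x.
Proof. by rewrite -scaleN1r ell2_normZ normcN normc1 mul1r. Qed.

HB.instance Definition _ := Num.Zmodule_isNormed.Build R ell2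
  ell2_normD ell2_norm_eq0 ell2_normMn ell2_normN.

Definition ell2_delta (n : int) : int -> R[i] := fun k => (k == n)%:R.

Lemma ell2_delta_subproof n : ell2_delta n \in ell2_pred.
Proof.
apply/asboolP; apply/square_summableE.
rewrite /sqnorm (_ : \esum_(k in _) _ = 1%E) ?ltry//.
rewrite (esumID [set n]); last by move=> k _; rewrite lee_fin sqr_ge0.
rewrite setTI esum_set1 ?lee_fin ?sqr_ge0// esum1.
  by rewrite /ell2_delta eqxx normc1 expr1n adde0.
by move=> k [_ /= kn]; rewrite /ell2_delta; case: eqP => //;
  rewrite normc0 expr0n.
Qed.

Definition ell2_basis (n : int) : ell2 := Ell2 (ell2_delta_subproof n).

End ell2_type.

Section operators.
Variable R : realType.
Implicit Types (T K : {linear ell2 R -> ell2 R}) (A : int -> int -> R[i]).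

(* The operator norm, [+oo] when the operator is unbounded. *)
Definition opnorm (f : ell2 R -> ell2 R) : \bar R :=
  ereal_sup [set (`|f x|)%:E | x in [set x | `|x| <= 1]].

Definition bounded_op (f : ell2 R -> ell2 R) : Prop := (opnorm f < +oo)%E.

Definition rank_le (n : nat) (f : ell2 R -> ell2 R) : Prop :=
  exists v : 'I_n -> ell2 R, forall x,
    exists c : 'I_n -> R[i], f x = \sum_(i < n) c i *: v i.

Definition singular_number (n : nat) T : \bar R :=
  ereal_inf [set opnorm (T \- K) | K in [set K | bounded_op K /\ rank_le n K]].

Definition schatten (p : R) T : Prop :=
  bounded_op T /\ (\sum_(0 <= n <oo) singular_number n T `^ p < +oo)%E.

(* The coordinate [T (ell2_basis R n) m] is the inner product of
   [T (ell2_basis R n)] with the [m]-th basis vector. *)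
Definition has_matrix T A : Prop :=
  forall m n : int, T (ell2_basis R n) m = A m n.

Definition matrix_bounded A : Prop :=
  exists T, has_matrix T A /\ bounded_op T.

Definition matrix_schatten (p : R) A : Prop :=
  exists T, has_matrix T A /\ schatten p T.

End operators.

(* Main.v *)
From HB Require Import structures.
Require Import Defs.
From mathcomp Require Import all_boot all_order all_algebra.
From mathcomp Require Import all_classical all_reals ereal topology sequences.
From mathcomp Require Import normedtype esum exp.
From mathcomp Require Import ring lra zify.
From mathcomp Require Import complex.
Set Implicit Arguments.
Unset Strict Implicit.
Unset Printing Implicit Defensive.
Import Order.TTheory GRing.Theory Num.Theory.
Import ComplexField.Normc.
Local Open Scope classical_set_scope.
Local Open Scope ring_scope.

(** Membership in a Schatten class contains boundedness, so two implications
    carry the content.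

    A bounded [A] has its [0]-th column in l^2.  That column is the sequence
    [a (m + 1)] multiplied by [1 / (m + 1/2) + 2], and this factor has modulus
    at least [1] except at [m = -1], where it vanishes; one entry of [a] does
    not affect summability ([square_summable_of_column]).

    Conversely let [s] be the squared l^2 norm of [a].  For each [N], write
    each of the two weights in [A] as a part supported on the [2N] indices
    closest to [-1/2] and a part supported outside.  The inner parts only
    involve [2N] rows and [2N] columns, hence have rank at most [4N]
    ([rank_le_difference]).  The outer parts form a Hilbert-Schmidt matrix: as
    the sum of [1 / (n + 1/2)^2] outside the block is [O(1/N)], its squared
    Hilbert-Schmidt norm is at most [64 s / (N + 1)] ([hs_remainder]).  A
    Hilbert-Schmidt operator of squared norm [h] has its [l]-th singular number
    at most [sqrt (h / (l + 1))]; spending [N] further ranks on the outer part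
    thus leaves an error of norm at most [8 sqrt s / (N + 1)].  The truncation
    and the Hilbert-Schmidt estimate each yield only a factor [N^(-1/2)], and
    together they give [s_n = O(1/n)] ([weighted_hankel_operator]), which is
    [p]-summable for every [p > 1] ([schatten_of_decay]).

    The bound on the singular numbers of a Hilbert-Schmidt operator
    ([singular_number_hs]) comes from a greedy choice: orthonormal vectors on
    which the operator is larger than [c] are picked one by one, each in the
    orthogonal complement of the previous ones.  By Bessel's inequality there
    are at most [h / c^2] of them, and when the choice stops the operator is
    bounded by [c] on the complement of their span.

    The inner product needed for this is defined by polarization, so that all
    of its properties follow from pointwise identities between finitely many
    squared moduli ([norm2_lincomb]). *)

(** * Nonnegative sums and complex moduli *)

Lemma esumZ_le (R : realType) (I : choiceType) (c : R) (f : I -> \bar R) :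
  0 <= c -> (forall i, (0 <= f i)%E) ->
  (\esum_(i in [set: I]) (c%:E * f i) <= c%:E * \esum_(i in [set: I]) f i)%E.
Proof.
move=> c0 f0; apply: ge_ereal_sup => _ [A [finA _] <-].
rewrite -ge0_mule_fsumr//; apply: lee_wpmul2l; first by rewrite lee_fin.
by apply: esum_ge; exists A.
Qed.

Lemma esumZ (R : realType) (I : choiceType) (c : R) (f : I -> \bar R) :
  0 <= c -> (forall i, (0 <= f i)%E) ->
  (\esum_(i in [set: I]) (c%:E * f i) = c%:E * \esum_(i in [set: I]) f i)%E.
Proof.
rewrite le_eqVlt => /predU1P[<- _|c0 f0].
  by rewrite mul0e esum1// => i _; rewrite mul0e.
apply/le_anti; rewrite (esumZ_le (ltW c0) f0)/=.
have : (\esum_(i in [set: I]) f i <=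
    c^-1%:E * \esum_(i in [set: I]) (c%:E * f i))%E.
  have := @esumZ_le _ _ c^-1 (fun i => c%:E * f i)%E.
  rewrite invr_ge0 ltW// => /(_ isT) h; apply: le_trans (h _); last first.
    by move=> i; rewrite mule_ge0// lee_fin ltW.
  by apply: le_esum => i _; rewrite muleA -EFinM mulVf ?gt_eqF// mul1e.
have c0' : (0 <= c%:E)%E by rewrite lee_fin ltW.
by move=> /(lee_wpmul2l c0'); rewrite muleA -EFinM mulfV ?gt_eqF// mul1e.
Qed.

Lemma normc_sqE (R : rcfType) (z : R[i]) :
  normc z ^+ 2 = complex.Re z ^+ 2 + complex.Im z ^+ 2.
Proof. by case: z => a b /=; rewrite sqr_sqrtr// addr_ge0 ?sqr_ge0. Qed.

(** * The inner product of l^2 *)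

Section inner_product.
Variable R : realType.
Implicit Types x y z : ell2 R.

Lemma ell2P x y : (forall k, x k = y k) -> x = y.
Proof. by move=> xy; apply/val_inj/funext. Qed.

Lemma ell2D x y k : (x + y) k = x k + y k. Proof. by []. Qed.

Lemma ell2N x k : (- x) k = - x k. Proof. by []. Qed.

Lemma ell2Z (c : R[i]) x k : (c *: x) k = c * x k. Proof. by []. Qed.

Definition ell2E := (ell2D, ell2N, ell2Z).

Lemma esum_normc2 x :
  \esum_(k in [set: int]) (normc (x k) ^+ 2)%:E = (`|x| ^+ 2)%:E.
Proof. exact: ell2_sqnormE. Qed.

(** A real linear relation between squared moduli that holds in every coordinate
    passes to the squared norms: once the terms are separated by the sign of
    their coefficients, it equates two sums of nonnegative families. *)
Lemma norm2_lincomb (s : seq (R * ell2 R)) :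
  (forall k, \sum_(p <- s) p.1 * normc (p.2 k) ^+ 2 = 0) ->
  \sum_(p <- s) p.1 * `|p.2| ^+ 2 = 0.
Proof.
move=> s0; pose pos (c : R) := Num.max c 0.
have pos0 c : 0 <= pos c by rewrite le_max lexx orbT.
have posB c : pos c - pos (- c) = c.
  by rewrite /pos; case: (leP c 0); case: (leP (- c) 0) => *; lra.
have esumE (f : R * ell2 R -> R) : (forall p, 0 <= f p) ->
    \esum_(k in [set: int]) (\sum_(p <- s) f p * normc (p.2 k) ^+ 2)%:E
    = (\sum_(p <- s) f p * `|p.2| ^+ 2)%:E.
  move=> f0; under eq_esum do rewrite -sumEFin.
  rewrite esum_sum => [|k p _ _]; last by rewrite lee_fin mulr_ge0 ?sqr_ge0.
  rewrite -sumEFin; apply: eq_bigr => p _.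
  under eq_esum do rewrite EFinM.
  rewrite esumZ => [||k]; rewrite ?lee_fin ?sqr_ge0//.
  by rewrite esum_normc2 EFinM.
have : \sum_(p <- s) pos p.1 * `|p.2| ^+ 2 =
       \sum_(p <- s) pos (- p.1) * `|p.2| ^+ 2.
  apply: EFin_inj; rewrite -!esumE//; apply: eq_esum => k _; congr EFin.
  apply/eqP; rewrite -subr_eq0 -sumrB; apply/eqP; rewrite -[RHS](s0 k).
  by apply: eq_bigr => p _; rewrite -mulrBl posB.
move=> /eqP; rewrite -subr_eq0 -sumrB => /eqP h.
by rewrite -[RHS]h; apply: eq_bigr => p _; rewrite -mulrBl posB.
Qed.

(** The real part of the inner product, by polarization. *)
Definition dotr x y : R := (`|x + y| ^+ 2 - `|x - y| ^+ 2) / 4.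

Lemma dotrC x y : dotr x y = dotr y x.
Proof. by rewrite /dotr (addrC x y) (distrC x y). Qed.

Lemma dotrr x : dotr x x = `|x| ^+ 2.
Proof.
by rewrite /dotr subrr normr0 -mulr2n normrMn; lra.
Qed.

(* Squared norms are made opaque before calling the decision procedure, which
   would otherwise unfold them when comparing atoms. *)
Local Ltac lincomb s :=
  suff: \sum_(p <- s) p.1 * `|p.2| ^+ 2 = 0;
    [rewrite !big_cons big_nil; cbn [fst snd];
     repeat match goal with |- context [@GRing.exp _ ?z 2] =>
       generalize (z ^+ 2); intro end; lra
    |apply: norm2_lincomb => ?; rewrite !big_cons big_nil; cbn [fst snd];
     rewrite !normc_sqE !ell2E].

Lemma dotrDl x y z : dotr (x + z) y = dotr x y + dotr z y.
Proof.
rewrite /dotr.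
lincomb ([:: (1, x + z + y); (1, x - y); (1, z - y);
            (-1, x + z - y); (-1, x + y); (-1, z + y)] : seq (R * ell2 R)).
move: (x _) (y _) => [xr xi] [yr yi]; move: (z _) => [zr zi] /=; ring.
Qed.

Lemma dotrZl (c : R) x y : dotr (c%:C%C *: x) y = c * dotr x y.
Proof.
suff h (u : ell2 R) : (forall k, u k = c%:C%C * x k) ->
  dotr u y = c * dotr x y by apply: h.
move=> uE; rewrite /dotr.
lincomb ([:: (1, u + y); (-1, u - y); (- c, x + y); (c, x - y)]
  : seq (R * ell2 R)).
rewrite uE; move: (x _) (y _) => [xr xi] [yr yi] /=; ring.
Qed.

Lemma dotrNl x y : dotr (- x) y = - dotr x y.
Proof.
have -> : - x = (-1)%:C%C *: x by rewrite rmorphN1 scaleN1r.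
by rewrite dotrZl mulN1r.
Qed.

Lemma scale_ii x : 'i%C *: ('i%C *: x) = - x.
Proof. by rewrite scalerA -expr2 sqr_i scaleN1r. Qed.

Lemma dotr_i x y : dotr ('i%C *: x) ('i%C *: y) = dotr x y.
Proof.
have n1 : normc ('i%C : R[i]) = 1.
  by rewrite /normc expr0n expr1n add0r sqrtr1.
rewrite /dotr -scalerDr -scalerBr.
rewrite -[`|_ *: (x + y)|]/(ell2_norm _) -[`|_ *: (x - y)|]/(ell2_norm _).
by rewrite !ell2_normZ n1 !mul1r.
Qed.

Lemma norm_basis n : `|ell2_basis R n| = 1.
Proof.
apply/eqP; rewrite -(@eqrXn2 _ 2)// expr1n; apply/eqP/EFin_inj.
rewrite -esum_normc2 (esumID [set n]) => [|k _]; last first.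
  by rewrite lee_fin sqr_ge0.
rewrite setTI esum_set1 ?lee_fin ?sqr_ge0// esum1.
  by rewrite /= /ell2_delta eqxx normc1 expr1n adde0.
by move=> k [_ /= kn]; rewrite /ell2_delta; case: eqP => //;
  rewrite normc0 expr0n.
Qed.

(** The difference of squared moduli of [x + e] and [x - e], for [e] the [n]-th
    basis vector, lives at the coordinate [n] only; it is therefore a multiple
    of the squared modulus of [e], with a coefficient depending on [x n]. *)
Lemma dotr_basis x n : dotr x (ell2_basis R n) = complex.Re (x n).
Proof.
rewrite /dotr; have e1 := norm_basis n; set e := ell2_basis R n in e1 *.
suff : \sum_(p <- ([:: (1, x + e); (-1, x - e); (- (4 * complex.Re (x n)), e)]
    : seq (R * ell2 R))) p.1 * `|p.2| ^+ 2 = 0.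
  by rewrite !big_cons big_nil/= e1; lra.
apply: norm2_lincomb => k; rewrite !big_cons big_nil; cbn [fst snd].
rewrite !normc_sqE !ell2E /e /= /ell2_delta.
have [->|kn] := eqVneq k n; case: (x _) => xr xi/=; ring.
Qed.

Lemma dotr_ibasis x n : dotr x ('i%C *: ell2_basis R n) = complex.Im (x n).
Proof.
rewrite -dotr_i scale_ii dotrC dotrNl dotrC dotr_basis ell2Z.
by case: (x n) => a b /=; ring.
Qed.

Definition dot x y : R[i] := (dotr x y +i* dotr x ('i%C *: y))%C.

Arguments dot : simpl never.

Lemma dotDl x y z : dot (x + z) y = dot x y + dot z y.
Proof. by rewrite /dot !dotrDl. Qed.

Lemma dotr_il x y : dotr ('i%C *: x) y = - dotr x ('i%C *: y).
Proof. by rewrite -[LHS]dotr_i scale_ii dotrNl. Qed.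

(** Homogeneity in the first argument follows from real homogeneity and from
    the case of the scalar [i], where the two components of [dot] are exchanged
    because multiplication by [i] is an isometry. *)
Lemma dotZl c x y : dot (c *: x) y = c * dot x y.
Proof.
case: c => a b.
have -> : (a +i* b)%C *: x = a%:C%C *: x + b%:C%C *: ('i%C *: x).
  by rewrite scalerA -scalerDl; congr (_ *: _); simpc.
rewrite /dot !dotrDl !dotrZl !dotr_il scale_ii (dotrC x (- y)) dotrNl (dotrC y).
by simpc; congr (_ +i* _)%C; ring.
Qed.

Lemma dotC x y : dot y x = (dot x y)^*%C.
Proof.
rewrite /dot/= dotrC; congr (_ +i* _)%C.
by rewrite dotrC dotr_il.
Qed.

Lemma dotxx x : dot x x = (`|x| ^+ 2)%:C%C.
Proof.
rewrite /dot dotrr; congr (_ +i* _)%C.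
by have := dotr_il x x; rewrite dotrC; lra.
Qed.

Lemma dot_basis x n : dot x (ell2_basis R n) = x n.
Proof. by rewrite /dot dotr_basis dotr_ibasis; case: (x n). Qed.

End inner_product.

(** * Orthonormal systems and Bessel's inequality *)

Section orthonormal.
Variable R : realType.
Implicit Types (x y z : ell2 R) (u : nat -> ell2 R).

Lemma normc_sqJ (z : R[i]) : (normc z ^+ 2)%:C%C = z * z^*%C.
Proof.
by rewrite normc_sqE; case: z => a b; simpc; congr (_ +i* _)%C; ring.
Qed.

Lemma normc_real (c : R) : normc c%:C%C = `|c|.
Proof. by rewrite /normc /= expr0n addr0 sqrtr_sqr. Qed.

Lemma ell2_norm_scale (c : R[i]) x : `|c *: x| = normc c * `|x|.
Proof. exact: ell2_normZ. Qed.

Lemma dot0l y : dot 0 y = 0.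
Proof. by rewrite -(scale0r 0) dotZl mul0r. Qed.

Lemma dotNl x y : dot (- x) y = - dot x y.
Proof. by rewrite -scaleN1r dotZl mulN1r. Qed.

Lemma dot_suml I (s : seq I) (F : I -> ell2 R) y :
  dot (\sum_(i <- s) F i) y = \sum_(i <- s) dot (F i) y.
Proof.
elim: s => [|i s IH]; first by rewrite !big_nil dot0l.
by rewrite !big_cons dotDl IH.
Qed.

Lemma dotDr x y z : dot x (y + z) = dot x y + dot x z.
Proof. by rewrite (dotC (y + z)) (dotC y) (dotC z) dotDl rmorphD. Qed.

Lemma dotZr c x y : dot x (c *: y) = c^*%C * dot x y.
Proof. by rewrite (dotC (_ *: y)) (dotC y) dotZl rmorphM. Qed.

Lemma dotNr x y : dot x (- y) = - dot x y.
Proof. by rewrite (dotC (- y)) (dotC y) dotNl rmorphN. Qed.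

Lemma dot_sumr I (s : seq I) (F : I -> ell2 R) x :
  dot x (\sum_(i <- s) F i) = \sum_(i <- s) dot x (F i).
Proof.
rewrite dotC dot_suml rmorph_sum/=; apply: eq_bigr => i _.
by rewrite (dotC (F i)).
Qed.

(** With a sequence indexed by all of [nat] and a bound [k], appending a vector
    is a change of the value at [k]. *)
Definition orthonormal u k :=
  forall i j, (i < k)%N -> (j < k)%N -> dot (u i) (u j) = (i == j)%:R.

Definition orthoproj u k x : ell2 R := \sum_(i < k) dot x (u i) *: u i.

Lemma dot_orthoproj_compl u k x j : orthonormal u k -> (j < k)%N ->
  dot (x - orthoproj u k x) (u j) = 0.
Proof.
move=> ou jk; rewrite dotDl dotNl dot_suml (bigD1 (Ordinal jk))//= big1.
  by rewrite dotZl ou// eqxx mulr1 addr0 subrr.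
by move=> i; rewrite -val_eqE/= => ij; rewrite dotZl ou// (negbTE ij) mulr0.
Qed.

Lemma norm_orthoproj_compl u k x : orthonormal u k ->
  `|x - orthoproj u k x| ^+ 2 =
  `|x| ^+ 2 - \sum_(i < k) normc (dot x (u i)) ^+ 2.
Proof.
(* The complement of the projection is orthogonal to the projection, so its
   inner product with itself equals its inner product with [x]. *)
move=> ou; apply: (@complexI R); rewrite -dotxx.
rewrite dotDr dotNr [X in _ - X]dot_sumr big1 ?subr0 => [|i _]; last first.
  by rewrite dotZr dot_orthoproj_compl// mulr0.
rewrite dotDl dotNl dotxx rmorphB rmorph_sum dot_suml; congr (_ - _).
by apply: eq_bigr => i _; rewrite dotZl [RHS]normc_sqJ -dotC.
Qed.

Lemma bessel u k x : orthonormal u k ->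
  \sum_(i < k) normc (dot x (u i)) ^+ 2 <= `|x| ^+ 2.
Proof.
by move=> ou; have h := norm_orthoproj_compl x ou; rewrite -subr_ge0 -h sqr_ge0.
Qed.

Lemma norm_orthoproj_compl_le u k x : orthonormal u k ->
  `|x - orthoproj u k x| <= `|x|.
Proof.
move=> ou; have h := norm_orthoproj_compl x ou.
rewrite -(@ler_pXn2r _ 2)// ?nnegrE// h.
by rewrite gerBl sumr_ge0// => i _; exact: sqr_ge0.
Qed.

Definition normalize x : ell2 R := (`|x|^-1)%:C%C *: x.

Lemma normalizeK x : x != 0 -> x = `|x|%:C%C *: normalize x.
Proof.
by move=> x0; rewrite scalerA -rmorphM mulfV ?normr_eq0// rmorph1 scale1r.
Qed.

Lemma norm_normalize x : x != 0 -> `|normalize x| = 1.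
Proof.
move=> x0; rewrite ell2_norm_scale normc_real ger0_norm ?invr_ge0//.
by rewrite mulVf// normr_eq0.
Qed.

(** This is Bessel's inequality for the single vector [y], normalized. *)
Lemma cauchy_schwarz x y :
  normc (dot x y) ^+ 2 <= `|x| ^+ 2 * `|y| ^+ 2.
Proof.
have [->|y0] := eqVneq y 0.
  by rewrite dotC dot0l conjc0 normc0 expr0n mulr_ge0// sqr_ge0.
have ou : orthonormal (fun=> normalize y) 1.
  by move=> [|//] [|//] _ _; rewrite dotxx norm_normalize// expr1n.
rewrite [in dot x y](normalizeK y0) dotZr conjc_real normcM exprMn mulrC.
rewrite normc_real normr_id ler_wpM2r ?sqr_ge0//.
by have := bessel x ou; rewrite big_ord1.
Qed.

End orthonormal.

(** * Singular numbers of Hilbert-Schmidt operators *)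

Section hilbert_schmidt.
Variable R : realType.
Implicit Types (x y z : ell2 R) (u : nat -> ell2 R) (r : int -> ell2 R).

(** [dot] is conjugate-linear on the right: [r m] is the conjugate of the [m]-th
    row of the matrix of [X]. *)
Definition has_rows (X : ell2 R -> ell2 R) r := forall x m, X x m = dot x (r m).

(** The squared Hilbert-Schmidt norm of the matrix with rows [r]. *)
Definition hs2 r : \bar R := \esum_(m in [set: int]) (`|r m| ^+ 2)%:E.

Lemma has_rows_ex r h : (hs2 r <= h%:E)%E ->
  exists2 X : {linear ell2 R -> ell2 R}, has_rows X r &
    forall x, `|X x| ^+ 2 <= h * `|x| ^+ 2.
Proof.
move=> rh.
have le x : (sqnorm (fun m => dot x (r m)) <= (h * `|x| ^+ 2)%:E)%E.
  apply: (@le_trans _ _ ((`|x| ^+ 2)%:E * hs2 r)%E); last first.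
    by rewrite (mulrC h) (EFinM _ h) lee_wpmul2l// lee_fin sqr_ge0.
  rewrite /hs2 -esumZ ?sqr_ge0//.
  by apply: le_esum => m _; rewrite -EFinM lee_fin cauchy_schwarz.
have Xin x : (fun m => dot x (r m)) \in @ell2_pred R.
  apply/asboolP/square_summableE.
  by apply: le_lt_trans (le x) (ltry _).
pose f x := Ell2 (Xin x).
have flin : linear f.
  by move=> c x y; apply/val_inj/funext => m /=; rewrite dotDl dotZl.
pose lf := GRing.isLinear.Build _ _ _ _ f flin.
pose X : {linear ell2 R -> ell2 R} := HB.pack f lf.
exists X => // x.
rewrite -lee_fin -[(_ ^+ 2)%:E]/((ell2_norm (f x)) ^+ 2)%:E -ell2_sqnormE.
exact: (le x).
Qed.

(** This sums Bessel's inequality for the rows, since the coordinates of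
    [X (u i)] are the inner products of [u i] with the rows. *)
Lemma hs2_orthonormal X r u k : has_rows X r -> orthonormal u k ->
  ((\sum_(i < k) `|X (u i)| ^+ 2)%:E <= hs2 r)%E.
Proof.
move=> Xr ou; rewrite -sumEFin.
under eq_bigr do rewrite -esum_normc2.
rewrite -esum_sum => [|m i _ _]; last by rewrite lee_fin sqr_ge0.
apply: le_esum => m _; rewrite sumEFin lee_fin.
apply: le_trans (bessel (r m) ou); apply: ler_sum => i _.
rewrite Xr dotC; case: dot => a b /=.
by rewrite sqrrN.
Qed.

(** If [X] exceeds [c] somewhere on the complement of the vectors chosen so far,
    then, after projecting to that complement and normalizing, the witness is a
    further orthonormal vector on which [X] exceeds [c]: the projection does not
    increase the norm, so it does not decrease the ratio. *)
Lemma greedy_orthonormal (X : {linear ell2 R -> ell2 R}) (c : R) k : 0 <= c ->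
  (exists u l, [/\ (l < k)%N, orthonormal u l &
     forall x, `|X (x - orthoproj u l x)| <= c * `|x|]) \/
  (exists2 u, orthonormal u k & forall i, (i < k)%N -> c < `|X (u i)|).
Proof.
move=> c0; elim: k => [|k [[u [l [lk ou ul]]]|[u ou uc]]].
- by right; exists (fun=> 0).
- by left; exists u, l; split=> //; exact: ltnW.
- case: (pselect (forall x, `|X (x - orthoproj u k x)| <= c * `|x|)) => [h|].
    by left; exists u, k.
  move=> /existsNP[x /negP]; rewrite -ltNge => cx; right.
  set y := x - orthoproj u k x in cx.
  have y0 : y != 0.
    apply: contraTneq cx => ->; rewrite linear0 normr0 -leNgt.
    by rewrite mulr_ge0.
  pose v i := if i == k then normalize y else u i.
  have yu j : (j < k)%N -> dot (normalize y) (u j) = 0.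
    by move=> jk; rewrite dotZl dot_orthoproj_compl// mulr0.
  exists v => [i j|i].
    rewrite !ltnS (leq_eqVlt i) (leq_eqVlt j) /v.
    case: (eqVneq i k) => [->|ik]; case: (eqVneq j k) => [->|jk]//=.
    - by rewrite dotxx norm_normalize// expr1n.
    - by move=> _ jk'; rewrite yu// eq_sym (negbTE jk).
    - by move=> ik' _; rewrite dotC yu// conjc0 (negbTE ik).
    - exact: ou.
  rewrite ltnS leq_eqVlt /v; case: (eqVneq i k) => //= [_ _|ik]; last exact: uc.
  rewrite linearZ/= ell2_norm_scale normc_real ger0_norm ?invr_ge0//.
  rewrite mulrC ltr_pdivlMr ?normr_gt0//; apply: le_lt_trans cx.
  by rewrite ler_wpM2l// norm_orthoproj_compl_le.
Qed.

Lemma opnorm_le (f : ell2 R -> ell2 R) (C : R) : 0 <= C ->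
  (forall x, `|f x| <= C * `|x|) -> (opnorm f <= C%:E)%E.
Proof.
move=> C0 fC; apply: ge_ereal_sup => _ [x /= x1 <-].
by rewrite lee_fin (le_trans (fC x))// ler_piMr.
Qed.

Lemma rank_leD m n (f g : ell2 R -> ell2 R) :
  rank_le m f -> rank_le n g -> rank_le (m + n) (fun x => f x + g x).
Proof.
move=> [v hv] [w hw].
exists (fun i => match fintype.split i with inl j => v j | inr j => w j end).
move=> x.
have [c fc] := hv x; have [d gd] := hw x.
exists (fun i => match fintype.split i with inl j => c j | inr j => d j end).
rewrite fc gd big_split_ord/=; congr (_ + _); apply: eq_bigr => i _.
  by rewrite (fintype.unsplitK (inl i)).
by rewrite (fintype.unsplitK (inr i)).
Qed.

Lemma rank_le_sum (I : eqType) (s : seq I) (v : I -> ell2 R)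
    (c : ell2 R -> I -> R[i]) :
  rank_le (size s) (fun x => \sum_(i <- s) c x i *: v i).
Proof.
exists (fun i => v (tnth (in_tuple s) i)) => x.
by exists (fun i => c x (tnth (in_tuple s) i)); rewrite big_tnth.
Qed.

Lemma rank_le_widen m n (f : ell2 R -> ell2 R) :
  (m <= n)%N -> rank_le m f -> rank_le n f.
Proof.
move=> mn hf; rewrite -(subnKC mn).
have -> : f = (fun x => f x + 0) by apply/funext => x; rewrite addr0.
apply: rank_leD hf _; exists (fun=> 0) => x; exists (fun=> 0).
by rewrite big1// => i _; rewrite scaler0.
Qed.

Lemma singular_number_le n (T K : {linear ell2 R -> ell2 R}) (C : R) :
  0 <= C -> bounded_op K -> rank_le n K ->
  (forall x, `|T x - K x| <= C * `|x|) -> (singular_number n T <= C%:E)%E.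
Proof.
move=> C0 bK rK TK; apply: le_trans (opnorm_le C0 TK).
by apply: ereal_inf_lbound; exists K.
Qed.

(** If [T] is a Hilbert-Schmidt perturbation of an operator [F] of rank [k],
    then [l] further ranks bring the distance to [T] down to the quantity [c]
    with [(l + 1) c^2 = h].  Indeed [l + 1] orthonormal vectors on which [T - F]
    exceeds [c] would make its squared Hilbert-Schmidt norm larger than [h], so
    the greedy choice stops after at most [l] vectors; the approximant is [F]
    plus [T - F] composed with the projection on them. *)
Lemma singular_number_hs k l n (T F : {linear ell2 R -> ell2 R}) r (B h : R) :
  0 <= B -> (forall x, `|T x| <= B * `|x|) ->
  rank_le k F -> has_rows (fun x => T x - F x) r -> 0 <= h ->
  (hs2 r <= h%:E)%E -> (k + l <= n)%N ->
  (singular_number n T <= (Num.sqrt (h / l.+1%:R))%:E)%E.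
Proof.
move=> B0 TB rF rr h0 rh kln; set c := Num.sqrt _.
have c0 : 0 <= c by exact: sqrtr_ge0.
have c2 : c ^+ 2 * l.+1%:R = h.
  by rewrite sqr_sqrtr ?divr_ge0// divfK// pnatr_eq0.
pose D : {linear ell2 R -> ell2 R} := T \- F.
have [[u [j [jl ou uj]]]|[u ou uc]] := @greedy_orthonormal D c l.+1 c0.
  pose P := fun x => orthoproj u j x.
  have Plin : linear P.
    move=> a x y; rewrite /P /orthoproj scaler_sumr -big_split/=.
    by apply: eq_bigr => i _; rewrite dotDl dotZl scalerDl scalerA.
  pose lP := GRing.isLinear.Build _ _ _ _ P Plin.
  pose LP : {linear ell2 R -> ell2 R} := HB.pack P lP.
  pose K : {linear ell2 R -> ell2 R} := F \+ (D \o LP).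
  have TK x : T x - K x = D (x - P x).
    by rewrite [RHS]linearB/= !opprD !opprK !addrA.
  have Kb x : `|T x - K x| <= c * `|x| by rewrite TK; exact: uj.
  apply: (@singular_number_le _ _ K) => //.
    apply: (@le_lt_trans _ _ (B + c)%:E); last exact: ltry.
    apply: opnorm_le => [|x]; first exact: addr_ge0.
    rewrite mulrDl -[K x](subKr (T x)) (le_trans (ler_normB _ _))//.
    exact: lerD.
  apply: (@rank_le_widen (k + j)).
    by rewrite (leq_trans _ kln)// leq_add2l.
  apply: rank_leD rF _; exists (fun i => D (u i)) => x.
  exists (fun i : 'I_j => dot x (u i)).
  rewrite [LHS](linear_sum D).
  by apply: eq_bigr => i _; rewrite linearZ.
have := le_trans (hs2_orthonormal rr ou) rh; rewrite lee_fin => h1.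
suff : \sum_(i < l.+1) c ^+ 2 < \sum_(i < l.+1) `|T (u i) - F (u i)| ^+ 2.
  move=> /lt_le_trans/(_ h1).
  by rewrite sumr_const card_ord -mulr_natr c2 ltxx.
apply: ltr_sum => [|i _].
  by apply/hasP; exists ord0; rewrite ?mem_index_enum.
by rewrite ltr_pXn2r// ?nnegrE//; exact: uc.
Qed.

End hilbert_schmidt.

(** * The numerical series *)

Section series.
Variable R : realType.

Lemma nneseries_le (f : nat -> R) (M : R) : (forall k, 0 <= f k) ->
  (forall n, \sum_(0 <= k < n) f k <= M) ->
  (\sum_(0 <= k <oo) (f k)%:E <= M%:E)%E.
Proof.
move=> f0 fM; apply: lime_le.
  by apply: is_cvg_nneseries => k _ _; rewrite lee_fin.
by apply: nearW => n; rewrite sumEFin lee_fin.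
Qed.

(** Write [G n] for the partial sums and [q = 2^(1-p) < 1].  Bounding both terms
    [(2k)^(-p)] and [(2k + 1)^(-p)] by the first gives
    [G (2n + 1) <= 1 + q G n]; as [G n <= G (2n + 1)], this bounds [G n] by
    [1 / (1 - q)]. *)
Lemma pseries_le (p : R) n : 1 < p ->
  \sum_(0 <= k < n) k.+1%:R `^ (- p) <= (1 - 2 `^ (1 - p))^-1.
Proof.
move=> p1; set q := 2 `^ (1 - p); pose g k : R := k.+1%:R `^ (- p).
pose G n := \sum_(0 <= k < n) g k.
have g0 k : 0 <= g k by exact: powR_ge0.
have gle i j : (i <= j)%N -> g j <= g i.
  move=> ij; rewrite /g !powRN lef_pV2 ?posrE ?powR_gt0//.
  by rewrite ge0_ler_powR ?nnegrE ?ler_nat// (le_trans _ (ltW p1)).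
have q1 : q < 1.
  rewrite /q -opprB powRN invf_lt1 ?powR_gt0//.
  rewrite -[ltLHS](congr1 (@^~ (p - 1)) (powR1 R)).
  by rewrite gt0_ltr_powR ?nnegrE ?subr_gt0// ltrDl.
have g2 k : 2 * g k.*2.+1 = q * g k.
  rewrite /g /q -doubleS -mul2n natrM powRM// powRD; last first.
    by rewrite pnatr_eq0 implybT.
  by rewrite powRr1// mulrA.
have G2 m : G m.*2.+1 <= 1 + q * G m.
  elim: m => [|m IH].
    by rewrite /G big_nat1 big_nil mulr0 addr0 /g powR1.
  rewrite /G doubleS !(@big_nat_recr _ _ _ _.+1) //= -/(G _).
  rewrite (big_nat_recr m)//=.
  rewrite -/(G m) mulrDr addrA -g2 -addrA lerD// mulrDl mul1r lerD//.
  exact: gle.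
have GnG m : G m <= G m.*2.+1.
  have mm : (m <= m.*2.+1)%N by lia.
  by rewrite /G (big_cat_nat (leq0n m) mm)/= lerDl sumr_ge0.
rewrite -/(G n) -[X in _ <= X]mul1r ler_pdivlMr ?subr_gt0//.
rewrite mulrBr mulr1 lerBlDr mulrC.
exact: le_trans (GnG n) (G2 n).
Qed.

Lemma esum_swap (I J : choiceType) (f : I -> J -> \bar R) :
  (forall i j, (0 <= f i j)%E) ->
  (\esum_(i in [set: I]) \esum_(j in [set: J]) f i j =
   \esum_(j in [set: J]) \esum_(i in [set: I]) f i j)%E.
Proof.
move=> f0; rewrite !esum_esum//.
rewrite (reindex_esum ([set: J] `*`` (fun=> [set: I])) _
  (fun x : J * I => (x.2, x.1)))//.
by split=> // [[a b] [c d] _ _ [<- <-]//|[a b] _]; exists (b, a).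
Qed.

(** The two integers [k] and [- k - 1] are at the same distance [k + 1/2] from
    [-1/2], the point of symmetry of the weights. *)
Definition level (n : int) : nat := match n with Posz k | Negz k => k end.

Lemma esum_level (f : nat -> R) : (forall k, 0 <= f k) ->
  (\esum_(n in [set: int]) (f (level n))%:E =
   (\sum_(0 <= k <oo) (f k)%:E) *+ 2)%E.
Proof.
move=> f0.
rewrite (esumID [set Posz k | k in [set: nat]]) => [|n _]; last first.
  by rewrite lee_fin.
have -> : [set: int] `&` ~` [set Posz k | k in [set: nat]] =
          [set Negz k | k in [set: nat]].
  apply/seteqP; split=> [[k|k] [_ /= h]|_ [k _ <-]]; last by split=> //= -[].
  - by exfalso; apply: h; exists k.
  - by exists k.
rewrite setTI !esum_image; try by move=> i j _ _ [].
by rewrite -!nneseries_esumT// => k; rewrite lee_fin.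
Qed.

(** The bound telescopes, because
    [(k + 1/2)^(-2) <= 8 / (k + 1) - 8 / (k + 2)].  The constant [8] makes this
    true from [k = 0] on (with equality there), so that a single estimate
    covers the full series, [N = 0], as well. *)
Lemma tail_series_le N :
  (\sum_(0 <= k <oo) (if (k < N)%N then 0 else (k%:R + 1 / 2) ^- 2)%:E
   <= (8 / N.+1%:R : R)%:E)%E.
Proof.
have b0 k : 0 <= (if (k < N)%N then 0 else (k%:R + 1 / 2) ^- 2) :> R.
  by case: ifP => // _; rewrite invr_ge0 sqr_ge0.
apply: nneseries_le => // n.
suff : \sum_(0 <= k < n) (if (k < N)%N then 0 else (k%:R + 1 / 2) ^- 2)
    <= 8 / N.+1%:R - 8 / (maxn N n).+1%:R :> R.
  by move/le_trans; apply; rewrite gerBl divr_ge0.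
elim: n => [|n IH]; first by rewrite big_nil maxn0 subrr.
rewrite big_nat_recr//=; case: ltnP => nN.
  by move: IH; rewrite addr0 (maxn_idPl (ltnW nN)) (maxn_idPl nN).
move: IH; rewrite (maxn_idPr nN) (maxn_idPr (leqW nN)).
set x : R := n%:R; have x0 : 0 <= x by rewrite ler0n.
have -> : n.+1%:R = x + 1 by rewrite -natr1.
have -> : n.+2%:R = x + 2 by rewrite -!natr1 -/x; lra.
suff : (x + 1 / 2) ^- 2 <= 8 / (x + 1) - 8 / (x + 2).
  by move=> h1 h2; apply: le_trans (lerD h2 h1) _; rewrite addrA subrK.
rewrite -subr_ge0 [X in 0 <= X](_ : _ =
  (7 * x ^+ 2 + 5 * x) / ((x + 1 / 2) ^+ 2 * ((x + 1) * (x + 2)))).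
  rewrite divr_ge0// ?mulr_ge0 ?addr_ge0 ?mulr_ge0 ?sqr_ge0//; lra.
field; apply/and3P; split; apply: lt0r_neq0; lra.
Qed.

End series.

(** * The weights and their truncations *)

Section weights.
Variable R : realType.

Definition weight (n : int) : R[i] := 1 / (n%:~R + 1 / 2).

Lemma weight_real m : weight m = ((m%:~R + 1 / 2 : R)^-1%:C)%C.
Proof.
rewrite /weight.
by rewrite !(rmorphD, rmorphM, fmorphV, rmorph1, rmorph_int, rmorph_nat) !mul1r.
Qed.

Lemma normc_weight n : normc (weight n) ^+ 2 = ((level n)%:R + 1 / 2) ^- 2.
Proof.
rewrite weight_real normc_real real_normK ?num_real// exprVn; congr (_ ^-1).
case: n => k //=.
have -> : (Negz k)%:~R = - (k%:R + 1) :> R by rewrite NegzE mulrNz natr1.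
by field.
Qed.

Definition weight_out N (n : int) : R[i] :=
  if (level n < N)%N then 0 else weight n.

Definition weight_in N (n : int) : R[i] :=
  if (level n < N)%N then weight n else 0.

Lemma weight_inE N n : weight_in N n = weight n - weight_out N n.
Proof.
by rewrite /weight_in /weight_out; case: ifP => _; rewrite ?subr0 ?subrr.
Qed.

Lemma esum_weight_out N :
  (\esum_(n in [set: int]) (normc (weight_out N n) ^+ 2)%:E
   <= (16 / N.+1%:R)%:E)%E.
Proof.
pose f k : R := if (k < N)%N then 0 else (k%:R + 1 / 2) ^- 2.
have f0 k : 0 <= f k by rewrite /f; case: ifP => // _; rewrite invr_ge0 sqr_ge0.
rewrite (eq_esum (b := fun n => (f (level n))%:E)) => [|n _]; last first.
  rewrite /weight_out /f; case: ifP => _; first by rewrite normc0 expr0n.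
  by rewrite normc_weight.
have le8 := tail_series_le R N.
rewrite esum_level// mule2n (le_trans (leeD le8 le8))//.
by rewrite -EFinD lee_fin -mulrDl -natrD.
Qed.

Definition block N : seq int :=
  [seq Posz k | k <- iota 0 N] ++ [seq Negz k | k <- iota 0 N].

Lemma mem_block N n : (n \in block N) = (level n < N)%N.
Proof.
have Posz_inj : injective Posz by move=> i j [].
have Negz_inj : injective Negz by move=> i j [].
rewrite mem_cat; case: n => k /=.
  rewrite mem_map// mem_iota add0n leq0n/= orbC.
  by case: mapP => // -[].
rewrite (mem_map Negz_inj) mem_iota add0n leq0n/=.
by case: mapP => // -[].
Qed.

Lemma block_uniq N : uniq (block N).
Proof.
rewrite cat_uniq !map_inj_uniq ?iota_uniq; try by move=> i j [].
by rewrite andbT/=; apply/hasPn => _ /mapP[k _ ->]; apply/mapP => -[].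
Qed.

Lemma size_block N : size (block N) = (N + N)%N.
Proof. by rewrite size_cat !size_map size_iota. Qed.

(** Off the block both sides vanish, because the inner weight does. *)
Lemma sum_weight_in N (g : int -> R[i]) k :
  \sum_(n <- block N) g n * weight_in N n * (k == n)%:R = g k * weight_in N k.
Proof.
have [kN|kN] := boolP (k \in block N).
  rewrite (bigD1_seq k)//= ?block_uniq// eqxx mulr1 big1 ?addr0// => n.
  by rewrite eq_sym => /negbTE ->; rewrite mulr0.
rewrite {2}/weight_in -mem_block (negbTE kN) mulr0 big1_seq// => n /= nN.
by case: eqP kN => [->|_]; rewrite ?nN// mulr0.
Qed.

End weights.

(** * The weighted Hankel matrix of a square summable sequence *)

Section hankel.
Variables (R : realType) (a : int -> R[i]) (s : R).
Hypothesis sqnorm_a : sqnorm a = s%:E.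

Lemma sqnorm_a_ge0 : 0 <= s.
Proof. by rewrite -lee_fin -sqnorm_a sqnorm_ge0. Qed.

Lemma sqnorm_shift (m : int) :
  \esum_(n in [set: int]) (normc (a (m + n + 1)) ^+ 2)%:E = s%:E.
Proof.
rewrite -sqnorm_a /sqnorm.
rewrite [RHS](reindex_esum [set: int] _ (fun n => m + n + 1))//.
split=> // [i j _ _ /addIr/addrI//|k _]; exists (k - 1 - m) => //.
by rewrite addrC addrCA addrC; lia.
Qed.

(** The conjugate of the part of the matrix that carries outer weights; [N = 0]
    gives the whole matrix. *)
Definition remainder N (m n : int) : R[i] :=
  (a (m + n + 1) * (weight_out R N m + weight_out R N n))^*%C.

Lemma normc_conj (z : R[i]) : normc z^*%C = normc z.
Proof. by case: z => x y /=; rewrite sqrrN. Qed.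

(** By [|v + w|^2 <= 2 |v|^2 + 2 |w|^2] the sum splits into two terms that are
    exchanged by transposition.  In each of them one index enters the weight
    only, and summing over the other one gives [s]. *)
Lemma hs_remainder N :
  (\esum_(m in [set: int]) sqnorm (remainder N m) <= (64 * s / N.+1%:R)%:E)%E.
Proof.
pose b m := normc (weight_out R N m) ^+ 2.
pose c k := normc (a k) ^+ 2.
have b0 m : 0 <= b m by exact: sqr_ge0.
have c0 m : 0 <= c m by exact: sqr_ge0.
have b2 m : 0 <= 2 * b m by exact: mulr_ge0 (ler0n _ 2) (b0 m).
have bc m n : 0 <= 2 * b m * c n by exact: mulr_ge0 (b2 m) (c0 n).
have colsum m : (\esum_(n in [set: int]) (2 * b m * c (m + n + 1)%R)%:E =
                 (2 * s)%:E * (b m)%:E)%E.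
  under eq_esum do rewrite EFinM.
  rewrite esumZ//; last by move=> ?; rewrite lee_fin.
  by rewrite sqnorm_shift -!EFinM mulrAC.
pose U := (\esum_(m in [set: int]) \esum_(n in [set: int])
  (2 * b m * c (m + n + 1)%R)%:E)%E.
have UE : (U <= (32 * s / N.+1%:R)%:E)%E.
  rewrite /U (eq_esum (fun m _ => colsum m)).
  rewrite esumZ ?mulr_ge0 ?sqnorm_a_ge0//.
  have s2 : (0 <= (2 * s)%:E :> \bar R)%E.
    by rewrite lee_fin mulr_ge0 ?sqnorm_a_ge0.
  apply: le_trans (lee_wpmul2l s2 (esum_weight_out R N)) _.
  rewrite -EFinM lee_fin; set v : R := N.+1%:R.
  suff -> : 2 * s * (16 / v) = 32 * s / v by [].
  by rewrite mulrA; congr (_ * _); ring.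
apply: (@le_trans _ _ (U + U)%E); last first.
  apply: le_trans (leeD UE UE) _.
  by rewrite -EFinD lee_fin -mulrDl -mulrDl -natrD.
have swapU : U = (\esum_(n in [set: int]) \esum_(m in [set: int])
    (2 * b m * c (m + n + 1)%R)%:E)%E.
  by rewrite /U esum_swap// => m n; rewrite lee_fin bc.
rewrite {2}swapU /U -esumD; last 2 first.
- by move=> m _; apply: esum_ge0 => n _; rewrite lee_fin bc.
- by move=> m _; apply: esum_ge0 => n _; rewrite lee_fin bc.
apply: le_esum => m _; rewrite -esumD; last 2 first.
- by move=> n _; rewrite lee_fin bc.
- by move=> n _; rewrite lee_fin bc.
apply: le_esum => n _; rewrite -EFinD lee_fin normc_conj normcM exprMn.
rewrite (addrC n m) -mulrDl mulrC.
apply: ler_wpM2r; first exact: c0.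
have := normcD2 (weight_out R N m) (weight_out R N n) ltr01.
by rewrite invr1.
Qed.

Lemma remainder_rows N : exists2 r : int -> ell2 R,
  (forall m n, r m n = remainder N m n) & (hs2 r <= (64 * s / N.+1%:R)%:E)%E.
Proof.
have le := hs_remainder N.
have rin m : remainder N m \in @ell2_pred R.
  apply/asboolP/square_summableE; apply: le_lt_trans (ltry _).
  apply: le_trans le; apply: esum_ge; exists [set m]; first by split.
  by rewrite fsbig_set1.
exists (fun m => Ell2 (rin m)) => //.
apply: le_trans le; apply: le_esum => m _.
by rewrite -esum_normc2.
Qed.

Lemma ell2_sum I (t : seq I) (F : I -> ell2 R) k :
  (\sum_(i <- t) F i) k = \sum_(i <- t) F i k.
Proof.
elim: t => [|i t IH]; first by rewrite !big_nil.
by rewrite !big_cons ell2D IH.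
Qed.

(** The difference of the two remainders carries the inner weights.  The weights
    attached to the columns produce combinations of the [2N] shifts of [a], and
    those attached to the rows produce combinations of [2N] basis vectors. *)
Lemma rank_le_difference N (r0 rN : int -> ell2 R) (F : ell2 R -> ell2 R) :
  (forall m n, r0 m n = remainder 0 m n) ->
  (forall m n, rN m n = remainder N m n) ->
  (forall x m, F x m = dot x (r0 m - rN m)) ->
  rank_le (4 * N) F.
Proof.
move=> r0E rNE FE.
have ain m : (fun n => a (m + n + 1)) \in @ell2_pred R.
  by apply/asboolP/square_summableE; rewrite /sqnorm sqnorm_shift ltry.
have ajin m : (fun n => (a (m + n + 1))^*%C) \in @ell2_pred R.
  apply/asboolP/square_summableE; rewrite /sqnorm.
  by under eq_esum do rewrite normc_conj; rewrite sqnorm_shift ltry.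
pose A m : ell2 R := Ell2 (ain m); pose AJ m : ell2 R := Ell2 (ajin m).
have rE m : r0 m - rN m = (weight_in R N m)^*%C *: AJ m +
    \sum_(n <- block N) (a (m + n + 1) * weight_in R N n)^*%C *: ell2_basis R n.
  apply: ell2P => k; rewrite !ell2E ell2_sum.
  rewrite r0E rNE /remainder.
  under eq_bigr => n _.
    rewrite ell2Z [ell2_basis _ _ _]/= /ell2_delta.
    rewrite -[(k == n)%:R]conjc_nat -rmorphM.
    over.
  rewrite -rmorph_sum/= sum_weight_in -!rmorphM -rmorphB -rmorphD/=.
  congr (_^*%C).
  by rewrite !weight_inE /weight_out/=; ring.
have FxE : F = (fun x =>
    \sum_(n <- block N) (weight_in R N n * dot x (AJ n)) *: ell2_basis R n
    + \sum_(n <- block N) (weight_in R N n * x n) *: A n).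
  apply/funext => x; apply: ell2P => m.
  rewrite ell2D !ell2_sum FE rE dotDr dotZr conjcK.
  congr (_ + _).
    under eq_bigr => n _ do rewrite ell2Z (mulrC (weight_in _ _ _)).
    by rewrite sum_weight_in mulrC.
  rewrite dot_sumr; apply: eq_bigr => n _.
  by rewrite dotZr conjcK dot_basis ell2Z/= (addrC n m); ring.
rewrite FxE; apply: (@rank_le_widen _ (size (block N) + size (block N))).
  by rewrite size_block; lia.
by apply: rank_leD; exact: rank_le_sum.
Qed.

(** The [n]-th singular number is estimated with [N = n / 5]: the inner part has
    rank at most [4N], and [N] more ranks serve to approximate the remainder. *)
Lemma weighted_hankel_operator : exists T : {linear ell2 R -> ell2 R},
  [/\ forall m n, T (ell2_basis R n) m =
        a (m + n + 1) * (weight R m + weight R n),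
      bounded_op T &
      exists2 C : R, 0 <= C &
        forall n, (singular_number n T <= (C / n.+1%:R)%:E)%E].
Proof.
have [r0 r0E r0h] := remainder_rows 0.
have [T Tr Tb] := has_rows_ex r0h.
have s0 := sqnorm_a_ge0.
have normb (h : R) (X : ell2 R -> ell2 R) : 0 <= h ->
    (forall x, `|X x| ^+ 2 <= h * `|x| ^+ 2) ->
    forall x, `|X x| <= Num.sqrt h * `|x|.
  move=> h0 Xh x; rewrite -(@ler_pXn2r _ 2)// ?nnegrE ?mulr_ge0 ?sqrtr_ge0//.
  by rewrite exprMn (sqr_sqrtr h0).
have h0 : 0 <= 64 * s / 1%:R by rewrite divr_ge0 ?mulr_ge0.
have TB := normb _ _ h0 Tb.
exists T; split.
- move=> m n; rewrite Tr dotC dot_basis r0E conjcK.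
  by rewrite /weight_out.
- apply: (le_lt_trans (opnorm_le (sqrtr_ge0 _) TB)); exact: ltry.
(* The factor [5] accounts for [n + 1 <= 5 (N + 1)]. *)
exists (5 * Num.sqrt (64 * s)) => [|n]; first by rewrite mulr_ge0 ?sqrtr_ge0.
pose N := (n %/ 5)%N.
have [rN rNE rNh] := remainder_rows N.
have [X Xr Xb] := has_rows_ex rNh.
have hN : 0 <= 64 * s / N.+1%:R by rewrite divr_ge0 ?mulr_ge0.
have rk : rank_le (4 * N) (T \- X).
  apply: (@rank_le_difference N r0 rN) => // x m.
  by rewrite ell2D ell2N Tr Xr dotDr dotNr.
have : (singular_number n T <= (Num.sqrt (64 * s / N.+1%:R / N.+1%:R))%:E)%E.
  apply: (@singular_number_hs _ (4 * N) N n T (T \- X) rN _ _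
    (sqrtr_ge0 _) TB) => //.
    by move=> x m; rewrite /= opprB addrC subrK Xr.
  by rewrite /N; lia.
move=> /le_trans; apply; rewrite lee_fin.
rewrite -mulrA -invfM -expr2 sqrtrM ?mulr_ge0// -exprVn sqrtr_sqr.
rewrite ger0_norm ?invr_ge0// [X in _ <= X / _]mulrC -mulrA.
apply: ler_wpM2l; first exact: sqrtr_ge0.
rewrite ler_pdivlMr// mulrC ler_pdivrMr// -natrM ler_nat /N; lia.
Qed.

End hankel.

(** * Schatten classes and the converse implication *)

Section schatten.
Variable R : realType.

Lemma singular_number_ge0 n (T : {linear ell2 R -> ell2 R}) :
  (0 <= singular_number n T)%E.
Proof.
apply: le_ereal_inf_tmp => _ [K _ <-].
apply: (@le_trans _ _ (`|(T \- K) 0|)%:E); first by rewrite lee_fin.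
by apply: ereal_sup_ubound; exists 0 => //=; rewrite normr0.
Qed.

Lemma schatten_of_decay (p C : R) (T : {linear ell2 R -> ell2 R}) :
  1 < p -> 0 <= C -> bounded_op T ->
  (forall n, (singular_number n T <= (C / n.+1%:R)%:E)%E) -> schatten p T.
Proof.
move=> p1 C0 bT sT; split=> //.
have p0 : 0 <= p by rewrite (le_trans _ (ltW p1)).
apply: (@le_lt_trans _ _ (C `^ p * (1 - 2 `^ (1 - p))^-1)%:E); last exact: ltry.
apply: (@le_trans _ _ (\sum_(0 <= n <oo) (C `^ p * n.+1%:R `^ (- p))%:E)%E).
  apply: lee_nneseries => [n _ _|n _]; first exact: poweR_ge0.
  apply: (@le_trans _ _ ((C / n.+1%:R)%:E `^ p)%E).
    apply: gt0_ler_poweR => //; rewrite in_itv/= leey andbT.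
      exact: singular_number_ge0.
    by rewrite lee_fin divr_ge0.
  rewrite poweR_EFin lee_fin powRM ?invr_ge0// powRN.
  by rewrite -powR_inv1// powRAC powR_inv1 ?powR_ge0.
apply: nneseries_le => [k|n]; first by rewrite mulr_ge0 ?powR_ge0.
by rewrite -mulr_sumr ler_wpM2l ?powR_ge0// pseries_le.
Qed.

(** The factor [1 / (m + 1/2) + 2] is real.  For [m >= 0] it exceeds [2], and
    for [m <= -2] it is at least [4/3].  At [m = -1] it is zero, and the missing
    entry [a 0] is restored by a multiple of a basis vector. *)
Lemma square_summable_of_column (a x : int -> R[i]) :
  square_summable x ->
  (forall m, x m = a (m + 1) * (weight R m + weight R 0)) ->
  square_summable a.
Proof.
move=> /square_summableE xfin xE; apply/square_summableE.
pose y (m : int) : R[i] := ell2_basis R (-1) m.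
rewrite /sqnorm (reindex_esum [set: int] _ (fun m => m + 1))//; last first.
  by split=> // [i j _ _ /addIr//|k _]; exists (k - 1) => //; rewrite subrK.
have yfin : (sqnorm y < +oo)%E.
  by apply: ell2_predE; exact: ell2_valP.
apply: (@le_lt_trans _ _
  (1%:E * sqnorm x + (normc (a 0) ^+ 2)%:E * sqnorm y)%E); last first.
  have fx : sqnorm x \is a fin_num by rewrite ge0_fin_numE ?sqnorm_ge0.
  have fy : sqnorm y \is a fin_num by rewrite ge0_fin_numE ?sqnorm_ge0.
  by rewrite ltey_eq fin_numD !fin_numM.
apply: (@le_sqnorm_lin R 1 (normc (a 0) ^+ 2) x y (fun m => a (m + 1))) => //.
  exact: sqr_ge0.
move=> m; rewrite mul1r /y /= /ell2_delta.
have [->|m1] := eqVneq m (-1).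
  by rewrite addNr normc1 expr1n mulr1 lerDr sqr_ge0.
rewrite normc0 expr0n mulr0 addr0 xE normcM exprMn ler_peMr ?sqr_ge0//.
have -> : weight R m + weight R 0 = ((m%:~R + 1 / 2)^-1 + 2)%:C%C.
  rewrite !weight_real -rmorphD/= add0r; congr ((_ + _)%:C%C).
  by rewrite mul1r invrK.
rewrite normc_real real_normK ?num_real//.
suff h : -1 <= (m%:~R + 1 / 2)^-1 :> R by nra.
have [m0|m0] := leP 0 m.
  have t0 : 0 <= m%:~R :> R by rewrite ler0z.
  by apply: (@le_trans _ _ 0); [lra | rewrite invr_ge0; lra].
have t0 : m%:~R <= -2 :> R by rewrite (_ : -2 = (-2)%:~R) ?ler_int//; lia.
rewrite lerNl -invrN invf_le1; lra.
Qed.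

End schatten.

Theorem theorem14p9 (R : realType) (a : int -> R[i]) (p : R) (hp : 1 < p) :
  let A : int -> int -> R[i] := fun m n =>
    a (m + n + 1) * (1 / (m%:~R + 1 / 2) + 1 / (n%:~R + 1 / 2)) in
  [<-> matrix_bounded A; matrix_schatten p A; square_summable a].
Proof.
move=> A.
have bounded_summable : matrix_bounded A -> square_summable a.
  move=> [T [TA _]].
  apply: (@square_summable_of_column R a (T (ell2_basis R 0))).
    exact/asboolP/ell2_valP.
  by move=> m; rewrite TA /A addr0.
have summable_schatten : square_summable a -> matrix_schatten p A.
  move=> /square_summableE afin.
  have aE : sqnorm a = (fine (sqnorm a))%:E.
    by rewrite fineK// ge0_fin_numE ?sqnorm_ge0.
  have [T [TA bT [C C0 sT]]] := weighted_hankel_operator aE.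
  by exists T; split=> //; exact: schatten_of_decay hp C0 bT sT.
have schatten_bounded : matrix_schatten p A -> matrix_bounded A.
  by move=> [T [TA [bT _]]]; exists T.
tfae.
- by move=> /bounded_summable/summable_schatten.
- by move=> /schatten_bounded/bounded_summable.
- by move=> /summable_schatten/schatten_bounded.
Qed.
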